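(* Let $\mathcal{A}$ be a $(\Gamma,\lambda)$-commutative algebra and let $M$ be a free graded $\mathcal{A}$-module of rank $n$ admitting a basis of degree $\boldsymbol{\mu}\in\Gamma^n$. (i) For all $\boldsymbol{\nu}\in(\Gamma_{\!\mathcal{A}^\times})^n+\boldsymbol{\mu}$, there exists a basis of $M$ of degree $\boldsymbol{\nu}$. (ii) If $\mathcal{A}^0$ is a local ring, then, up to reordering its elements, the degree $\boldsymbol{\nu}$ of any basis of $M$ satisfies $\boldsymbol{\nu}\in(\Gamma_{\!\mathcal{A}^\times})^n+\boldsymbol{\mu}$.
   Context: $\mathbb{K}$ is a field of characteristic zero and $\Gamma$ is a finitely generated abelian group. $\lambda:\Gamma\times\Gamma\to\mathbb{K}^\times$ is a commutation factor: biadditive with $\lambda(x,y)\lambda(y,x)=1$. A $(\Gamma,\lambda)$-commutative algebra is an associative unital $\Gamma$-graded $\mathbb{K}$-algebra $\mathcal{A}=\bigoplus_\gamma\mathcal{A}^\gamma$ with $ab=\lambda(\tilde a,\tilde b)ba$ for homogeneous $a,b$ ($\tilde a$ is the degree). $\mathcal{A}^0$ is then a commutative ring. A graded $\mathcal{A}$-module is a graded vector space $M=\bigoplus_\gamma M^\gamma$ with left and right graded $\mathcal{A}$-module structures related by $ma=\lambda(\tilde m,\tilde a)am$. It is free of rank $n$ if it has a basis $(e_1,\dots,e_n)$ consisting of homogeneous elements (bases of graded modules always consist of homogeneous elements); the degree of the basis is $(\tilde e_1,\dots,\tilde e_n)\in\Gamma^n$. $\Gamma_{\!\mathcal{A}^\times}:=\{\gamma\in\Gamma:\mathcal{A}^\gamma\cap\mathcal{A}^\times\neq\emptyset\}$,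 where $\mathcal{A}^\times$ is the group of invertible elements of $\mathcal{A}$; it is a subgroup of $\Gamma$. *)

(* Defs.v *)
From mathcomp Require Import all_boot all_order all_algebra.
From mathcomp Require Import classical_sets.

Set Implicit Arguments.
Unset Strict Implicit.
Unset Printing Implicit Defensive.

Import GRing.Theory.
Local Open Scope classical_set_scope.
Local Open Scope ring_scope.

Definition finitely_generated (G : zmodType) : Prop :=
  exists s : seq G, forall x : G,
    exists c : 'I_(size s) -> int, x = \sum_(i < size s) s`_i *~ c i.

(* lambda x y is nonzero by comm_factorV, so lambda does take values in K^x. *)
Record commutation_factor (K : fieldType) (G : zmodType)
    (lambda : G -> G -> K) : Prop := CommutationFactor {
  comm_factorDl : forall x y z, lambda (x + y) z = lambda x z * lambda y z;
  comm_factorDr : forall x y z, lambda x (y + z) = lambda x y * lambda x z;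
  comm_factorV : forall x y, lambda x y * lambda y x = 1
}.

(* V is the internal direct sum of the pieces D g; the index set G may be
   infinite, so sums run over finite sequences of indices. *)
Definition direct_sum (G V : zmodType) (D : G -> set V) : Prop :=
  (forall v : V, exists (s : seq G) (f : G -> V),
     (forall g, D g (f g)) /\ v = \sum_(g <- s) f g) /\
  (forall (s : seq G) (f : G -> V), uniq s -> (forall g, D g (f g)) ->
     \sum_(g <- s) f g = 0 -> forall g, g \in s -> f g = 0).

(* Closure under opposites is the case k = -1 of scalar multiplication. *)
Definition subspace (K : fieldType) (V : zmodType) (scale : K -> V -> V)
    (D : set V) : Prop :=
  [/\ D 0, forall u v, D u -> D v -> D (u + v)
    & forall k u, D u -> D (scale k u)].

Record graded_comm_algebra (K : fieldType) (G : zmodType)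
    (lambda : G -> G -> K) (A : algType K) (Agr : G -> set A) : Prop :=
  GradedCommAlgebra {
  ga_subspace : forall x, subspace (fun (k : K) (a : A) => k *: a) (Agr x);
  ga_direct : direct_sum Agr;
  ga_mul : forall x y a b, Agr x a -> Agr y b -> Agr (x + y) (a * b);
  ga_comm : forall x y a b, Agr x a -> Agr y b ->
    a * b = lambda x y *: (b * a)
}.

Record right_action (R : pzRingType) (M : zmodType) (ract : M -> R -> M)
    : Prop := RightAction {
  ractDl : forall m m' a, ract (m + m') a = ract m a + ract m' a;
  ractDr : forall m a b, ract m (a + b) = ract m a + ract m b;
  ractA : forall m a b, ract (ract m a) b = ract m (a * b);
  ract1 : forall m, ract m 1 = m
}.

(* The left structure is the lmodType one, the right structure is ract, and
   the K-vector space structure is restriction of scalars along k |-> k%:A. *)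
Record graded_module (K : fieldType) (G : zmodType) (lambda : G -> G -> K)
    (A : algType K) (Agr : G -> set A) (M : lmodType A) (Mgr : G -> set M)
    (ract : M -> A -> M) : Prop := GradedModule {
  gm_subspace : forall x,
    subspace (fun (k : K) (m : M) => (k%:A : A) *: m) (Mgr x);
  gm_direct : direct_sum Mgr;
  gm_left : forall x y a m, Agr x a -> Mgr y m -> Mgr (x + y) (a *: m);
  gm_ract : right_action ract;
  gm_right : forall x y m a, Mgr x m -> Agr y a -> Mgr (x + y) (ract m a);
  gm_compat : forall x y m a, Mgr x m -> Agr y a ->
    ract m a = (lambda x y *: a) *: m
}.

(* For homogeneous e_i, the compatibility of the two actions makes left and
   right bases the same. *)
Definition is_basis (R : pzRingType) (M : lmodType R) (n : nat)
    (e : 'I_n -> M) : Prop :=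
  forall m : M, exists! c : {ffun 'I_n -> R}, m = \sum_i c i *: e i.

Definition basis_of_degree (G : zmodType) (R : pzRingType) (M : lmodType R)
    (Mgr : G -> set M) (n : nat) (e : 'I_n -> M) (mu : {ffun 'I_n -> G})
    : Prop :=
  is_basis e /\ forall i, Mgr (mu i) (e i).

Definition invertible (R : pzRingType) (a : R) : Prop :=
  exists b, a * b = 1 /\ b * a = 1.

Definition unit_degrees (G : Type) (R : pzRingType) (Agr : G -> set R)
    : set G :=
  [set g | exists a, Agr g a /\ invertible a].

(* The translate U^n + mu in G^n. *)
Definition power_translate (G : zmodType) (U : set G) (n : nat)
    (mu : {ffun 'I_n -> G}) : set {ffun 'I_n -> G} :=
  [set nu | exists g : {ffun 'I_n -> G}, (forall i, U (g i)) /\ nu = g + mu].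

(* Ideals of a commutative subring S of R, as subsets of R. *)
Definition ideal_of (R : pzRingType) (S I : set R) : Prop :=
  [/\ I `<=` S, I 0, forall a b, I a -> I b -> I (a + b)
    & forall r a, S r -> I a -> I (r * a)].

Definition maximal_ideal_of (R : pzRingType) (S I : set R) : Prop :=
  [/\ ideal_of S I, I <> S
    & forall J, ideal_of S J -> I `<=` J -> J = I \/ J = S].

Definition local_subring (R : pzRingType) (S : set R) : Prop :=
  exists! I : set R, maximal_ideal_of S I.

(* Main.v *)
(* Any two bases of M expand in one another with homogeneous coefficients.  In
   the identity [e_i = sum_j d_j e'_j = sum_j d_j sum_k c_jk f_k], where [f] is a
   basis with [f_i = e_i], the i-th coordinate reads [1 = sum_j d_j c_ji] in
   [A^0].  If [A^0] is local, some [d_j c_ji] is a unit, hence so is [c_ji],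
   whose degree is [nu_j - mu_i], and replacing [f_i] by [e'_j] gives a basis
   again.  Exchanging the vectors of [e] one at a time in this way produces the
   reordering; it is injective and surjective because a basis over a nonzero
   ring has no repeated vector and no proper subfamily that is a basis. *)
Require Import Defs.
From mathcomp Require Import all_boot all_order all_algebra.
From mathcomp Require Import boolp classical_sets.

Set Implicit Arguments.
Unset Strict Implicit.
Unset Printing Implicit Defensive.

Import GRing.Theory.
Local Open Scope classical_set_scope.
Local Open Scope ring_scope.

(* [phi] gives the homogeneous components of [v]; quantifying over all large
   enough supports allows components to be added without aligning supports. *)
Definition components (G V : zmodType) (D : G -> set V) (v : V) (phi : G -> V)
    : Prop :=
  (forall g, D g (phi g)) /\
  exists s : seq G, forall T : seq G, uniq T -> {subset s <= T} ->
    v = \sum_(g <- T) phi g.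

(** * Homogeneous components in a direct sum *)

Section Components.

Variables (G V : zmodType) (D : G -> set V).
Hypothesis D0 : forall g, D g 0.
Hypothesis DB : forall g u v, D g u -> D g v -> D g (u - v).
Hypothesis D_direct : direct_sum D.

Let DD g u v : D g u -> D g v -> D g (u + v).
Proof. by move=> Du Dv; rewrite -[v]opprK -[- v]sub0r; apply/(DB Du)/DB. Qed.

Lemma components_exist v : exists phi, components D v phi.
Proof.
have [/(_ v)[s [f [Df ->]]] _] := D_direct.
(* The sequence [s] may repeat an index, so the component at [g] collects [f g] with its
   multiplicity; it vanishes off [s]. *)
exists (fun g => f g *+ count_mem g s); split=> [g|].
  by elim: count => [|k IHk]; rewrite ?mulr0n // mulrS; apply: DD.
exists s => T T_uniq sT.
rewrite -(big_undup_iterop_count _ s xpredT f).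
rewrite [RHS](bigID (mem s)) /= [X in _ + X]big1 ?addr0; last first.
  by move=> g gs; rewrite (count_memPn gs).
rewrite -[RHS]big_filter.
rewrite (perm_big [seq g <- T | g \in s]) /=; last first.
  apply: uniq_perm; rewrite ?undup_uniq ?filter_uniq // => g.
  by rewrite mem_undup mem_filter andb_idr // => /sT.
by [].
Qed.

Lemma components_homogeneous g v phi :
  D g v -> components D v phi -> phi g = v.
Proof.
move=> Dv [Dphi [s phis]]; have [_ D_indep] := D_direct.
set T := undup (g :: s).
have gT : g \in T by rewrite mem_undup mem_head.
have T_uniq : uniq T by apply: undup_uniq.
(* [v] placed in degree [g] alone is a second decomposition of [v]; the difference [f] of the two
   sums to zero, so independence applies to it. *)
pose f x := phi x - (if x == g then v else 0).
suff: f g = 0 by rewrite /f eqxx => /eqP; rewrite subr_eq0 => /eqP.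
apply: (D_indep T f) => // [x|]; rewrite /f.
  by case: eqP => [->|_]; apply: DB.
rewrite sumrB -phis => // [|x xs]; last by rewrite mem_undup inE xs orbT.
by rewrite -big_mkcond -big_filter filter_pred1_uniq // big_seq1 subrr.
Qed.

Lemma components_sum (I : finType) (v : I -> V) (phi : I -> G -> V) :
  (forall i, components D (v i) (phi i)) ->
  components D (\sum_i v i) (fun g => \sum_i phi i g).
Proof.
move=> v_phi; split=> [g|].
  by elim/big_ind: _ => // [|i _]; [exact: DD | have [] := v_phi i].
have /fin_all_exists[s phis] i := (v_phi i).2.
exists (flatten [seq s i | i : I]) => T T_uniq sT.
rewrite exchange_big; apply: eq_bigr => i _; apply: phis => // x xs.
by apply: sT; apply/flatten_imageP; exists i.
Qed.

End Components.

(** Meant for multiplication by a homogeneous element of degree [y]: it is additive and translates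
    degrees by [y], hence carries components to components. *)
Lemma components_shift (G V W : zmodType) (D : G -> set V) (E : G -> set W)
    (h : V -> W) (y : G) (v : V) (phi : G -> V) :
  {morph h : a b / a + b} ->
  (forall x a, D x a -> E (x + y) (h a)) ->
  components D v phi -> components E (h v) (fun g => h (phi (g - y))).
Proof.
move=> hD hDE [Dphi [s phis]]; split=> [g|].
  by rewrite -[X in E X](subrK y); apply: hDE.
have h0 : h 0 = 0 by apply: (addrI (h 0)); rewrite -hD !addr0.
exists [seq x + y | x <- s] => T T_uniq sT.
rewrite (phis [seq x - y | x <- T]); first last.
- move=> x xs; apply/mapP; exists (x + y); last by rewrite addrK.
  by apply: sT; apply: (map_f (fun x => x + y)).
- by rewrite map_inj_uniq //; apply: addIr.
by rewrite (big_morph h hD h0) big_map.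
Qed.

(** * Bases of modules over a noncommutative ring *)

Section Bases.

Variables (R : nzRingType) (M : lmodType R).

Lemma is_basisP n (e : 'I_n -> M) :
  is_basis e <->
  (forall m, exists c : 'I_n -> R, m = \sum_i c i *: e i) /\
  (forall c : 'I_n -> R, \sum_i c i *: e i = 0 -> forall i, c i = 0).
Proof.
split=> [e_basis|[e_gen e_free] m].
  split=> [m|c c0 i]; first by have [c [-> _]] := e_basis m; exists c.
  have [d [_ d_uniq]] := e_basis 0.
  have /ffunP/(_ i) : [ffun i => c i] = [ffun=> 0].
    rewrite -(d_uniq [ffun i => c i]).
      by apply: d_uniq; rewrite big1 // => j _; rewrite ffunE scale0r.
    by rewrite -[LHS]c0; apply: eq_bigr => j _; rewrite ffunE.
  by rewrite !ffunE.
have [c ->] := e_gen m; exists [ffun i => c i]; split.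
  by apply: eq_bigr => j _; rewrite ffunE.
move=> d /eqP; rewrite -subr_eq0 -sumrB => /eqP cd.
apply/ffunP => i; rewrite ffunE; apply/eqP; rewrite -subr_eq0; apply/eqP.
apply: (e_free (fun i => c i - d i)); rewrite -[RHS]cd.
by apply: eq_bigr => j _; rewrite scalerBl.
Qed.

Lemma basis_coord_inj n (e : 'I_n -> M) (c d : 'I_n -> R) :
  is_basis e -> \sum_i c i *: e i = \sum_i d i *: e i -> c =1 d.
Proof.
move=> /is_basisP[_ e_free] /eqP; rewrite -subr_eq0 -sumrB => /eqP cd i.
apply/eqP; rewrite -subr_eq0; apply/eqP.
apply: (e_free (fun i => c i - d i)); rewrite -[RHS]cd.
by apply: eq_bigr => j _; rewrite scalerBl.
Qed.

Lemma sum_delta n (e : 'I_n -> M) i :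
  \sum_j (j == i)%:R *: e j = e i.
Proof.
rewrite (bigD1 i) //= eqxx scale1r big1 ?addr0 // => j /negPf->.
by rewrite scale0r.
Qed.

Lemma basis_inj n (e : 'I_n -> M) : is_basis e -> injective e.
Proof.
move=> e_basis i j eij; apply/eqP; apply: contraT => /negPf nij.
have /(basis_coord_inj e_basis)/(_ i) :
    \sum_k (k == i)%:R *: e k = \sum_k (k == j)%:R *: e k.
  by rewrite !sum_delta.
by rewrite eqxx nij => /eqP; rewrite oner_eq0.
Qed.

(** Repeated indices would repeat a vector of the basis [e \o s]. If [j] were outside the image of
    [s], then [e j] would be a combination of the other vectors of [e], and the [j]-th coordinates
    would give 1 = 0. Equality of [n] and [p] is a by-product. *)
Lemma basis_sub_bij n p (e : 'I_p -> M) (s : 'I_n -> 'I_p) :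
  is_basis e -> is_basis (e \o s) -> bijective s.
Proof.
move=> e_basis es_basis.
have s_inj : injective s by move=> i j /(congr1 e)/(basis_inj es_basis).
have s_surj j : j \in codom s.
  apply: contraT => js; have /is_basisP[/(_ (e j))[c ej] _] := es_basis.
  have ejE : e j = \sum_k (\sum_(i | s i == k) c i) *: e k.
    rewrite ej (partition_big s xpredT) //=; apply: eq_bigr => k _.
    by rewrite scaler_suml; apply: eq_bigr => i /eqP ->.
  have /(basis_coord_inj e_basis)/(_ j) := etrans (sum_delta e j) ejE.
  rewrite eqxx big1 => [/eqP|i /eqP sij]; first by rewrite oner_eq0.
  by rewrite -sij codom_f in js.
apply: (inj_card_bij s_inj); rewrite -(card_codom s_inj) subset_leq_card //.
by apply/fintype.subsetP => j _.
Qed.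

Lemma basis_scale n (e : 'I_n -> M) (u : 'I_n -> R) :
  is_basis e -> (forall i, invertible (u i)) -> is_basis (fun i => u i *: e i).
Proof.
move=> /is_basisP[e_gen e_free] /fin_all_exists[w uw].
apply/is_basisP; split=> [m|c c0 i].
  have [c ->] := e_gen m; exists (fun i => c i * w i).
  by apply: eq_bigr => i _; rewrite scalerA -mulrA (uw i).2 mulr1.
have cu0 : c i * u i = 0.
  apply: (e_free (fun i => c i * u i)); rewrite -[RHS]c0.
  by apply: eq_bigr => j _; rewrite scalerA.
by rewrite -[c i]mulr1 -(uw i).1 mulrA cu0 mul0r.
Qed.

(** The new family is obtained from [f] by a matrix equal to the identity outside row [i], whose
    diagonal entry there is the unit [c i]; [sumE] is its action on coordinates. *)
Lemma basis_exchange n (f : 'I_n -> M) (c : 'I_n -> R) (i : 'I_n) :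
  is_basis f -> invertible (c i) ->
  is_basis (fun k => if k == i then \sum_j c j *: f j else f k).
Proof.
move=> /is_basisP[f_gen f_free] [b [cb bc]].
have sumE (a : 'I_n -> R) :
    \sum_k a k *: (if k == i then \sum_j c j *: f j else f k) =
    \sum_k (if k == i then a i * c i else a k + a i * c k) *: f k.
  rewrite (bigD1 i) //= [RHS](bigD1 i) //= eqxx [X in _ *: X](bigD1 i) //=.
  rewrite scalerDr scalerA -addrA; congr (_ + _).
  rewrite scaler_sumr -big_split; apply: eq_bigr => k /negPf -> /=.
  by rewrite scalerDl scalerA addrC.
apply/is_basisP; split=> [m|a].
  have [a ->] := f_gen m.
  (* These coordinates solve the system in [sumE]: first the [i]-th equation by means of [b], then
     the others. *)
  exists (fun k => if k == i then a i * b else a k - a i * b * c k).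
  rewrite sumE; apply: eq_bigr => k _; rewrite eqxx.
  by case: eqP => [->|_]; rewrite ?subrK // -mulrA bc mulr1.
rewrite sumE => /(f_free (fun k => if k == i then _ else _)) a0.
have ai0 : a i = 0.
  have := a0 i; rewrite eqxx => ac0.
  by rewrite -[a i]mulr1 -cb mulrA ac0 mul0r.
move=> k; have := a0 k; case: eqP => [-> //|_].
by rewrite ai0 mul0r addr0.
Qed.

End Bases.

(** * Sums of non-units in a local ring *)

(** By Zorn, each non-unit [x i] lies in a maximal ideal, which must be the unique one [m]. If no
    [x i] were a unit, their sum 1 would lie in [m]. *)
Lemma local_subring_sum1 (R : nzRingType) (S : set R) (I : finType)
    (x : I -> R) :
  S 0 -> S 1 -> (forall a b, S a -> S b -> S (a + b)) ->
  (forall a b, S a -> S b -> S (a * b)) ->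
  (forall a b, S a -> S b -> a * b = b * a) ->
  local_subring S -> (forall i, S (x i)) -> \sum_i x i = 1 ->
  exists i y, [/\ S y, y * x i = 1 & x i * y = 1].
Proof.
move=> S0 S1 SD SM SC [m [[m_ideal m_proper _] m_uniq]] Sx x1.
have [mS m0 mD mM] := m_ideal.
have idealM r a J : ideal_of S J -> S r -> J a -> J (r * a).
  by case=> _ _ _ JM; apply: JM.
have ideal1 J : ideal_of S J -> J 1 -> J = S.
  move=> J_ideal J1; have [JS _ _ _] := J_ideal.
  rewrite eqEsubset; split=> // a Sa.
  by rewrite -[a]mulr1; apply: idealM.
apply: contrapT => nunit; apply/m_proper/(ideal1 _ m_ideal).
rewrite -x1; elim/big_ind: _ => // i _.
have nunit_i r : S r -> r * x i <> 1.
  move=> Sr rx; apply: nunit; exists i, r; split=> //.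
  by rewrite SC.
(* [set0] is adjoined because it is the union of the empty chain. *)
pose P : set (set R) :=
  [set J | J = set0 \/ [/\ ideal_of S J, J (x i) & ~ J 1]].
have principal : P [set r * x i | r in S].
  right; split.
  - split.
    + by move=> _ [r Sr <-]; apply: SM.
    + by exists 0; rewrite ?mul0r.
    + move=> _ _ [r Sr <-] [t St <-]; exists (r + t); first exact: SD.
      by rewrite mulrDl.
    + move=> r _ Sr [t St <-]; exists (r * t); first exact: SM.
      by rewrite mulrA.
  - by exists 1; rewrite ?mul1r.
  - by case=> r /nunit_i.
have [F FP F_chain|J [PJ J_max]] := @Zorn_bigcup _ P.
  have F_total u v J1 J2 : F J1 -> F J2 -> J1 u -> J2 v ->
      exists J, [/\ F J, J u & J v].
    move=> FJ1 FJ2 J1u J2v.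
    by have [le12|le21] := F_chain _ _ FJ1 FJ2; [exists J2|exists J1];
      split=> //; [apply: le12|apply: le21].
  have nonempty J u : F J -> J u -> [/\ ideal_of S J, J (x i) & ~ J 1].
    by move=> FJ Ju; have [J0|//] := FP _ FJ; rewrite J0 in Ju.
  have [->|/set0P[u [J FJ Ju]]] := eqVneq (\bigcup_(X in F) X) set0.
    by left.
  have [[JS J0 JD JM] Jx _] := nonempty _ _ FJ Ju.
  right; split; [split| |].
  - by move=> v [L FL Lv]; have [[LS _ _ _] _ _] := nonempty _ _ FL Lv; apply: LS.
  - by exists J.
  - move=> v w [L1 FL1 L1v] [L2 FL2 L2w].
    have [L [FL Lv Lw]] := F_total _ _ _ _ FL1 FL2 L1v L2w.
    by have [[_ _ LD _] _ _] := nonempty _ _ FL Lv; exists L => //; apply: LD.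
  - move=> r v Sr [L FL Lv].
    by have [[_ _ _ LM] _ _] := nonempty _ _ FL Lv; exists L => //; apply: LM.
  - by exists J.
  - by case=> L FL L1; have [_ _] := nonempty _ _ FL L1; apply.
have [J0|[J_ideal Jx J1]] := PJ.
  (* The empty set is not maximal in [P]: the principal ideal of [x i] is strictly larger. *)
  exfalso; apply: J_max principal; rewrite J0 properEneq; split=> //.
  apply/eqP => /esym/seteqP[/(_ (x i)) xi _].
  by apply: xi; exists 1; rewrite ?mul1r.
rewrite (m_uniq J) //; split=> // [JS|L L_ideal JL].
  by apply: J1; rewrite JS.
have [L1|L1] := pselect (L 1); first by right; apply: ideal1.
left; apply: contrapT => LJ; apply: (J_max L); last first.
  by right; split=> //; apply: JL.
by rewrite properEneq; split=> //; apply/eqP => /esym.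
Qed.

(** * Graded commutative algebras *)

Section Graded.

Variables (K : fieldType) (G : zmodType) (lambda : G -> G -> K).
Hypothesis lambda_cf : commutation_factor lambda.
Variables (A : algType K) (Agr : G -> set A).
Hypothesis A_gca : graded_comm_algebra lambda Agr.

Lemma subspaceB (V : zmodType) (scale : K -> V -> V) (D : set V) u v :
  subspace scale D -> (forall w, scale (-1) w = - w) ->
  D u -> D v -> D (u - v).
Proof. by move=> [_ DD DZ] scaleN Du Dv; rewrite -scaleN; apply/DD/DZ. Qed.

Lemma gcaB x a b : Agr x a -> Agr x b -> Agr x (a - b).
Proof. by apply: (subspaceB (ga_subspace A_gca x)) => c; rewrite scaleN1r. Qed.

Lemma gca0 x : Agr x 0.
Proof. by case: (ga_subspace A_gca x). Qed.

Lemma comm_factor_neq0 x y : lambda x y != 0.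
Proof.
apply/eqP => l0; have := comm_factorV lambda_cf x y.
by rewrite l0 mul0r => /esym/eqP; rewrite oner_eq0.
Qed.

Lemma comm_factor00 : lambda 0 0 = 1.
Proof.
apply: (mulfI (comm_factor_neq0 0 0)).
by rewrite -comm_factorDl // addr0 mulr1.
Qed.

(** Comparing components of degree [y] in [1 * a = a] shows that the degree 0 component of 1 is a
    left identity on homogeneous elements. Applied to all components of 1, this makes it equal to
    1. *)
Lemma gca1 : Agr 0 1.
Proof.
have A_direct := ga_direct A_gca.
have [phi phi1] := components_exist gca0 gcaB A_direct 1.
have phi0 y a : Agr y a -> phi 0 * a = a.
  move=> Aa.
  have /(components_homogeneous gca0 gcaB A_direct Aa) :
      components Agr a (fun g => phi (g - y) * a).
    rewrite -[X in components _ X _]mul1r.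
    apply: (components_shift (h := fun b => b * a)) phi1 => [b c|x b Ab].
      by rewrite mulrDl.
    exact: ga_mul A_gca _ _ _ _ Ab Aa.
  by rewrite subrr.
have [Aphi [s /(_ (undup s) (undup_uniq s))]] := phi1.
move=> /(_ (fun x => etrans (mem_undup s x)))oneE.
suff <- : phi 0 = 1 by [].
rewrite -[LHS]mulr1 oneE mulr_sumr; apply: eq_bigr => g _.
exact: phi0 (Aphi g).
Qed.

(** * Homogeneous bases of graded modules *)

Section Modules.

Variables (M : lmodType A) (Mgr : G -> set M) (ract : M -> A -> M).
Hypothesis M_gm : graded_module lambda Agr Mgr ract.

Lemma gmB x u v : Mgr x u -> Mgr x v -> Mgr x (u - v).
Proof.
by apply: (subspaceB (gm_subspace M_gm x)) => w; rewrite scaleN1r scaleN1r.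
Qed.

Lemma gm0 x : Mgr x 0.
Proof. by case: (gm_subspace M_gm x). Qed.

(** Arbitrary coordinates of [m] are replaced by their components of degree [g - mu i]. The
    resulting sum is the component of [m] in degree [g], which is [m] itself. *)
Lemma homogeneous_coord n (e : 'I_n -> M) (mu : {ffun 'I_n -> G}) g m :
  basis_of_degree Mgr e mu -> Mgr g m ->
  exists c : 'I_n -> A,
    (forall i, Agr (g - mu i) (c i)) /\ m = \sum_i c i *: e i.
Proof.
move=> [/is_basisP[/(_ m)[c mE] _] e_mu] Mm.
have /fin_all_exists[phi c_phi] i :=
  components_exist gca0 gcaB (ga_direct A_gca) (c i).
exists (fun i => phi i (g - mu i)); split=> [i|].
  by have [] := c_phi i.
apply/esym.
apply: (components_homogeneous gm0 gmB (gm_direct M_gm) (g := g)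
  (phi := fun g => \sum_i phi i (g - mu i) *: e i)) => //.
rewrite mE; apply: (components_sum gm0 gmB) => i.
apply: (components_shift (h := fun a => a *: e i)) (c_phi i).
  by move=> a b; rewrite scalerDl.
by move=> x a Aa; apply: gm_left M_gm _ _ _ _ Aa _.
Qed.

(** Each basis vector is multiplied by a homogeneous unit of the required degree. *)
Lemma basis_of_degree_translate n (mu nu : {ffun 'I_n -> G}) (e : 'I_n -> M) :
  basis_of_degree Mgr e mu -> power_translate (unit_degrees Agr) mu nu ->
  exists f : 'I_n -> M, basis_of_degree Mgr f nu.
Proof.
move=> [e_basis e_mu] [g [/fin_all_exists[u ug] ->]].
exists (fun i => u i *: e i); split.
  by apply: basis_scale => // i; have [] := ug i.
by move=> i; rewrite ffunE; apply: gm_left M_gm _ _ _ _ (ug i).1 _.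
Qed.

(** [w * d] is a left inverse of [c]. Since [c * d] is a nonzero scalar multiple of [d * c], there
    is a right inverse too, and the two coincide. *)
Lemma factor_invertible x y c d w :
  Agr x c -> Agr y d -> w * (d * c) = 1 -> d * c * w = 1 -> invertible c.
Proof.
move=> Ac Ad wdc dcw; have linv : w * d * c = 1 by rewrite -mulrA.
have rinv : c * ((lambda x y)^-1 *: (d * w)) = 1.
  rewrite -scalerAr mulrA (ga_comm A_gca Ac Ad) -scalerAl dcw scalerA.
  by rewrite mulVf ?comm_factor_neq0 // scale1r.
exists (w * d); split=> //.
by rewrite -[w * d]mulr1 -{1}rinv [w * d * _]mulrA linv mul1r.
Qed.

Lemma homogeneous_exchange n p (f : 'I_n -> M) (mu : {ffun 'I_n -> G})
    (e : 'I_p -> M) (nu : {ffun 'I_p -> G}) (i : 'I_n) :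
  local_subring (Agr 0) ->
  basis_of_degree Mgr f mu -> basis_of_degree Mgr e nu ->
  exists j, unit_degrees Agr (nu j - mu i) /\
    is_basis (fun k => if k == i then e j else f k).
Proof.
move=> A_local f_deg e_deg; have [f_basis f_mu] := f_deg.
have [_ e_nu] := e_deg.
have [d [Ad fiE]] := homogeneous_coord e_deg (f_mu i).
have /fin_all_exists[c ejE] j := homogeneous_coord f_deg (e_nu j).
have Ac j k : Agr (nu j - mu k) (c j k) by have [] := ejE j.
have dc1 : \sum_j d j * c j i = 1.
  have : f i = \sum_k (\sum_j d j * c j k) *: f k.
    rewrite {1}fiE; under eq_bigr do rewrite (ejE _).2 scaler_sumr.
    rewrite exchange_big; apply: eq_bigr => k _.
    by rewrite scaler_suml; apply: eq_bigr => j _; rewrite scalerA.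
  rewrite -{1}(sum_delta f i) => /(basis_coord_inj f_basis)/(_ i).
  by rewrite eqxx.
have [_ A0D _] := ga_subspace A_gca 0.
have A0M a b : Agr 0 a -> Agr 0 b -> Agr 0 (a * b).
  by move=> Aa Ab; rewrite -[X in Agr X]addr0; apply: ga_mul A_gca _ _ _ _ Aa Ab.
have A0C a b : Agr 0 a -> Agr 0 b -> a * b = b * a.
  by move=> Aa Ab; rewrite (ga_comm A_gca Aa Ab) comm_factor00 scale1r.
(* The degrees [mu i - nu j] of [d j] and [nu j - mu i] of [c j i] cancel. *)
have A0dc j : Agr 0 (d j * c j i).
  have := ga_mul A_gca (Ad j) (Ac j i).
  by rewrite subrKA subrr.
have [j [w [_ wdc dcw]]] :=
  local_subring_sum1 (gca0 0) gca1 A0D A0M A0C A_local A0dc dc1.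
have c_inv := factor_invertible (Ac j i) (Ad j) wdc dcw.
exists j; split; first by exists (c j i).
by rewrite (ejE j).2; apply: basis_exchange.
Qed.

Lemma basis_of_degree_reorder n p (mu : {ffun 'I_n -> G})
    (nu : {ffun 'I_p -> G}) (e0 : 'I_n -> M) (e : 'I_p -> M) :
  local_subring (Agr 0) ->
  basis_of_degree Mgr e0 mu -> basis_of_degree Mgr e nu ->
  exists s : 'I_n -> 'I_p,
    bijective s /\
    power_translate (unit_degrees Agr) mu [ffun i => nu (s i)].
Proof.
move=> A_local [e0_basis e0_mu] e_deg; have [e_basis e_nu] := e_deg.
(* After k exchanges, [s i = Some j] records that e_j has replaced the i-th
   vector; an option is needed because p could a priori be 0. *)
have exchanged k : (k <= n)%N -> exists s : 'I_n -> option 'I_p,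
    [/\ forall i, s i = (i < k)%N :> bool,
        forall i j, s i = Some j -> unit_degrees Agr (nu j - mu i)
      & is_basis (fun i => oapp e (e0 i) (s i))].
  elim: k => [|k IHk] kn; first by exists (fun=> None); split.
  have [s [s_dom s_deg s_basis]] := IHk (ltnW kn).
  pose i0 := Ordinal kn.
  have si0 : s i0 = None by case: (s i0) (s_dom i0) => //=; rewrite ltnn.
  (* The degree of the current mixed basis. Position [i0] still holds its original vector, so the
     degree condition of the next exchange refers to [mu i0]. *)
  pose mu' := [ffun i => oapp nu (mu i) (s i)].
  have s_mu' : basis_of_degree Mgr (fun i => oapp e (e0 i) (s i)) mu'.
    by split=> [|i]; [exact: s_basis | rewrite ffunE; case: (s i) => [j|] /=].
  have [j [j_deg j_basis]] := homogeneous_exchange i0 A_local s_mu' e_deg.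
  rewrite ffunE si0 /= in j_deg.
  exists (fun i => if i == i0 then Some j else s i); split.
  - by move=> i; rewrite ltnS leq_eqVlt -val_eqE /= -s_dom; case: eqP.
  - by move=> i j'; case: eqP => [-> [<-]|_ /s_deg].
  - congr is_basis: j_basis; apply/funext => i.
    by case: eqP.
have [s [s_dom s_deg s_basis]] := exchanged n (leqnn n).
have /fin_all_exists[t st] i : exists j, s i = Some j.
  by have := s_dom i; rewrite ltn_ord; case: (s i) => // j; exists j.
exists t; split.
  (* After [n] exchanges the basis consists only of vectors of [e], indexed through [t], so [t] is a
     bijection. *)
  apply: (basis_sub_bij e_basis); congr is_basis: s_basis.
  by apply/funext => i; rewrite st.
exists [ffun i => nu (t i) - mu i]; split=> [i|].
  by rewrite ffunE; apply: s_deg.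
by apply/ffunP => i; rewrite !ffunE subrK.
Qed.

End Modules.

End Graded.

Theorem proposition3p4
    (K : fieldType) (K_char0 : [pchar K] =i pred0)
    (G : zmodType) (G_fg : finitely_generated G)
    (lambda : G -> G -> K) (lambda_cf : commutation_factor lambda)
    (A : algType K) (Agr : G -> set A)
    (A_gca : graded_comm_algebra lambda Agr)
    (M : lmodType A) (Mgr : G -> set M) (ract : M -> A -> M)
    (M_gm : graded_module lambda Agr Mgr ract)
    (n : nat) (mu : {ffun 'I_n -> G})
    (M_free : exists e : 'I_n -> M, basis_of_degree Mgr e mu) :
  (forall nu : {ffun 'I_n -> G},
     power_translate (unit_degrees Agr) mu nu ->
     exists e : 'I_n -> M, basis_of_degree Mgr e nu) /\
  (local_subring (Agr 0) ->
   forall (p : nat) (e : 'I_p -> M) (nu : {ffun 'I_p -> G}),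
     basis_of_degree Mgr e nu ->
     exists s : 'I_n -> 'I_p,
       bijective s /\
       power_translate (unit_degrees Agr) mu [ffun i => nu (s i)]).
Proof.
have [e0 e0_mu] := M_free.
split=> [nu|A_local p e nu]; first exact: (basis_of_degree_translate M_gm e0_mu).
exact: (basis_of_degree_reorder lambda_cf A_gca M_gm A_local e0_mu).
Qed.
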